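(* For every fixed edge-ordered graph $G$ with at least one edge, $ssat_m(n,G)=O(n\log n)$.
   Context: An edge-ordered graph is a finite simple graph together with a linear order on its edge set (usually given by an injective labeling $l:E\to\mathbb{N}$ or $l:E\to\mathbb{R}$). A copy of $G$ in an edge-ordered graph $H$ is a subgraph of $H$ (with the induced edge-order) isomorphic to $G$ by an isomorphism respecting the edge-order. $ssat_m(n,G)$ is the minimum number of edges in an edge-ordered graph $H$ on $n$ vertices (not required to be $G$-free) such that adding to $H$ any missing edge, inserted at the beginning of the linear order (i.e. with a label smaller than all labels of $H$), creates a new copy of $G$ (one using the added edge). Asymptotic notation is for $n\to\infty$ with $G$ fixed; the implied constant may depend on $G$. *)

(* Defs.v *)
From mathcomp Require Import all_boot.
From mathcomp Require Import boolp.

Set Implicit Arguments.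
Unset Strict Implicit.
Unset Printing Implicit Defensive.

(* A simple graph on V, its edges being 2-element subsets of V, with a linear
   order on the edges given by an injective labeling. Only the labels of edges
   are meaningful, and only through their relative order. *)
Record eograph (V : finType) := EOGraph {
  edges : {set {set V}};
  label : {set V} -> nat;
  edges_card2 : forall e : {set V}, e \in edges -> #|e| = 2;
  label_inj : {in edges &, injective label}
}.

Definition is_subgraph (V : finType) (H : eograph V)
    (W : {set V}) (F : {set {set V}}) : Prop :=
  F \subset edges H /\ forall e, e \in F -> e \subset W.

(* The subgraph (W, F) of H, with the edge order induced by H, is isomorphic
   to G as an edge-ordered graph. *)
Definition is_copy (T V : finType) (G : eograph T) (H : eograph V)
    (W : {set V}) (F : {set {set V}}) : Prop :=
  is_subgraph H W F /\
  exists f : T -> V,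
    [/\ injective f,
        f @: [set: T] = W,
        [set f @: (e : {set T}) | e in edges G] = F
      & {in edges G &, forall e1 e2 : {set T},
           (label H (f @: e1) < label H (f @: e2)) = (label G e1 < label G e2)}].

Definition add_label (V : finType) (H : eograph V) (e e' : {set V}) : nat :=
  if e' == e then 0 else (label H e').+1.

Lemma add_edges_card2 (V : finType) (H : eograph V) (e : {set V}) :
  #|e| = 2 -> forall e', e' \in e |: edges H -> #|e'| = 2.
Proof.
by move=> e2 e' /setU1P[->|/edges_card2].
Qed.

Lemma add_label_inj (V : finType) (H : eograph V) (e : {set V}) :
  {in e |: edges H &, injective (add_label H e)}.
Proof.
move=> a b; rewrite !inE /add_label.
case: eqP => [-> | _] /=; case: eqP => [-> | _] //= aH bH [].
exact: label_inj.
Qed.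

(* The labels of H are shifted by one, so that e comes first. *)
Definition add_first (V : finType) (H : eograph V) (e : {set V})
    (e2 : #|e| = 2) : eograph V :=
  EOGraph (@add_edges_card2 V H e e2) (@add_label_inj V H e).

Definition min_semisaturated (T V : finType) (G : eograph T) (H : eograph V)
    : Prop :=
  forall (e : {set V}) (e2 : #|e| = 2), e \notin edges H ->
  exists (W : {set V}) (F : {set {set V}}),
    is_copy G (add_first H e2) W F /\ e \in F.

Definition ssat_m_attains (T : finType) (G : eograph T) (n m : nat) : Prop :=
  exists H : eograph 'I_n, min_semisaturated G H /\ #|edges H| = m.

(* A complete graph has no missing edge. *)
Lemma ssat_m_attains_ex (T : finType) (G : eograph T) (n : nat) :
  exists m, `[< ssat_m_attains G n m >].
Proof.
pose E := [set e : {set 'I_n} | #|e| == 2].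
have E2 : forall e, e \in E -> #|e| = 2 by move=> e; rewrite inE => /eqP.
have lI : {in E &, injective (fun e : {set 'I_n} => enum_rank e : nat)}.
  by move=> a b _ _ /val_inj/enum_rank_inj.
exists #|E|; apply/asboolP; exists (EOGraph E2 lI); split=> //.
by move=> e e2; rewrite /= inE e2.
Qed.

Definition ssat_m (n : nat) (T : finType) (G : eograph T) : nat :=
  ex_minn (ssat_m_attains_ex G n).

(* Main.v *)
Require Import Defs.
From mathcomp Require Import all_boot all_order all_algebra.
From mathcomp Require Import all_classical all_reals all_analysis.
Import Order.TTheory GRing.Theory Num.Theory.
Import numFieldNormedType.Exports.

(** Let [xy] be the first edge of [G], [k = #|T|] and [2 ^ L >= n]. The first
    [k * L] vertices form a core, made of [L] copies of [V(G)], and [H] consists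
    of all the edges meeting the core. Seen from the [i]-th copy, a vertex
    outside the core plays [x] or [y] according to its [i]-th binary digit, and
    an edge to that copy is labeled primarily by the label in [G] of the edge
    whose role it plays. Two vertices [u], [v] outside the core differ in some
    digit [i], so adding [uv] completes a copy of [G] whose other vertices are
    in the [i]-th copy. *)

(** * Binary digits and lexicographic comparison *)

Lemma differ_bit (L u v : nat) : u < 2 ^ L -> v < 2 ^ L -> u != v ->
  exists2 i, i < L & odd (u %/ 2 ^ i) != odd (v %/ 2 ^ i).
Proof.
elim: L u v => [|L IHL] u v; first by rewrite !ltnS !leqn0 => /eqP-> /eqP->.
move=> ltu ltv neq_uv.
have [odd_uv|] := eqVneq (odd u) (odd v); last by exists 0; rewrite ?expn0 ?divn1.
have half_lt w : w < 2 ^ L.+1 -> w./2 < 2 ^ L.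
  by rewrite -divn2 ltn_divLR // expnSr.
have neq_half : u./2 != v./2.
  apply: contraNneq neq_uv => eq_half.
  by rewrite -(odd_double_half u) -(odd_double_half v) odd_uv eq_half.
have [i ltiL neq_i] := IHL _ _ (half_lt u ltu) (half_lt v ltv) neq_half.
by exists i.+1; rewrite // expnS !divnMA !divn2.
Qed.

Lemma ltn_lexi (M l1 r1 l2 r2 : nat) : r1 < M -> r2 < M -> l1 != l2 ->
  (l1 * M + r1 < l2 * M + r2) = (l1 < l2).
Proof.
move=> ltr1 ltr2; rewrite neq_ltn => /orP[lt12|lt21].
- rewrite lt12; have: l1.+1 * M <= l2 * M by rewrite leq_mul2r lt12 orbT.
  rewrite mulSn => le12; apply: leq_trans (leq_addr _ _).
  by apply: leq_trans le12; rewrite addnC ltn_add2r.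
- rewrite [RHS]ltnNge (ltnW lt21) ltnNge; apply/negbF.
  have: l2.+1 * M <= l1 * M by rewrite leq_mul2r lt21 orbT.
  rewrite mulSn => le21; apply: leq_trans (leq_addr _ _).
  by apply: leq_trans le21; rewrite addnC leq_add2r ltnW.
Qed.

(** * The core graph and its number of edges *)

Section Construction.

Variables (T : finType) (G : eograph T) (x y : T) (n L : nat).

Let k := #|T|.

Definition in_core (v : 'I_n) : bool := v < k * L.

Definition core_edges : {set {set 'I_n}} :=
  [set e : {set 'I_n} | (#|e| == 2) && [exists v in e, in_core v]].

Definition role (i : nat) (v : 'I_n) : T :=
  if in_core v then nth x (enum T) (v %% k)
  else if odd (v %/ 2 ^ i) then y else x.

(** The pick is arbitrary when both ends of [e] are in the core. This is harmless for the copies of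
    [G] built below: the core vertices of each of their edges all lie in one copy of V(G). *)
Definition copy_index (e : {set 'I_n}) : nat :=
  if [pick v in e | in_core v] is Some v then v %/ k else 0.

(* The rank only breaks ties between edges playing the same edge of [G]. *)
Definition core_label (e : {set 'I_n}) : nat :=
  label G (role (copy_index e) @: e) * #|{set 'I_n}| + enum_rank e.

Lemma core_edges_card2 (e : {set 'I_n}) : e \in core_edges -> #|e| = 2.
Proof. by rewrite inE => /andP[/eqP]. Qed.

Lemma core_label_inj : {in core_edges &, injective core_label}.
Proof.
(* The rank is below the factor [#|{set 'I_n}|], so reducing the label modulo this factor recovers
   it. *)
move=> e1 e2 _ _ /(congr1 (modn^~ #|{set 'I_n}|)).
by rewrite !modnMDl !modn_small // => /val_inj/enum_rank_inj.
Qed.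

Definition core_graph : eograph 'I_n :=
  EOGraph core_edges_card2 core_label_inj.

Lemma card_core_edges : #|core_edges| <= k * L * n.
Proof.
pose pair (p : 'I_(k * L) * 'I_n) :=
  [set w : 'I_n | (w == p.1 :> nat) || (w == p.2)].
suff sub : core_edges \subset pair @: predT.
  apply: leq_trans (subset_leq_card sub) _.
  by apply: leq_trans (leq_imset_card _ _) _; rewrite card_prod !card_ord.
apply/fintype.subsetP=> e; rewrite inE => /andP[/cards2P[a [b [_ ->]]]].
have mem (c d : 'I_n) : c < k * L -> [set c; d] \in pair @: predT.
  move=> ltc; apply/imsetP; exists (Ordinal ltc, d) => //.
  by apply/setP=> w; rewrite !inE.
by case/exists_inP=> v /set2P[]-> /mem //; rewrite finset.setUC.
Qed.

(** * The copy of [G] through an added edge *)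

Section Copy.

Variables (u v : 'I_n) (i : nat).
Hypotheses (neq_xy : x != y) (ltiL : i < L).
Hypotheses (u_out : ~~ in_core u) (v_out : ~~ in_core v).
Hypotheses (u_bit : ~~ odd (u %/ 2 ^ i)) (v_bit : odd (v %/ 2 ^ i)).

Definition copy_map (z : T) : 'I_n :=
  if z == x then u else if z == y then v
  else insubd u (i * k + index z (enum T)).

Lemma copy_mapx : copy_map x = u.
Proof. by rewrite /copy_map eqxx. Qed.

Lemma copy_mapy : copy_map y = v.
Proof. by rewrite /copy_map eqxx eq_sym (negPf neq_xy). Qed.

Lemma index_enum_lt (z : T) : index z (enum T) < k.
Proof. by rewrite /k cardE index_mem mem_enum. Qed.

Lemma copy_map_lt (z : T) : i * k + index z (enum T) < k * L.
Proof.
apply: (@leq_trans (i.+1 * k)); last by rewrite mulnC leq_mul2l ltiL orbT.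
by rewrite mulSn addnC ltn_add2r index_enum_lt.
Qed.

Lemma copy_map_core (z : T) : z != x -> z != y ->
  copy_map z = i * k + index z (enum T) :> nat.
Proof.
move=> /negPf zx /negPf zy; rewrite /copy_map zx zy val_insubd.
(* As [u] is outside the core, [k * L <= u < n]; hence the position is a valid vertex and [insubd]
   does not return its default. *)
rewrite (leq_trans (copy_map_lt z)) // ltnW // (leq_ltn_trans _ (ltn_ord u)) //.
by rewrite leqNgt.
Qed.

Lemma in_core_copy_map (z : T) : in_core (copy_map z) = (z != x) && (z != y).
Proof.
have [->|zx] := eqVneq z x; first by rewrite copy_mapx (negPf u_out).
have [->|zy] := eqVneq z y; first by rewrite copy_mapy (negPf v_out).
by rewrite /in_core copy_map_core // copy_map_lt.
Qed.

(** Digit [i] tells [u] from [v], and the residue modulo [k] decodes a core vertex. This yields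
    injectivity of [copy_map] and lets [core_label] read off the label in [G]. *)
Lemma copy_mapK : cancel copy_map (role i).
Proof.
move=> z; rewrite /role in_core_copy_map.
have [->|zx] := eqVneq z x; first by rewrite copy_mapx (negPf u_bit).
have [->|zy] := eqVneq z y; first by rewrite copy_mapy v_bit.
by rewrite copy_map_core // modnMDl modn_small ?index_enum_lt // nth_index ?mem_enum.
Qed.

Lemma copy_map_inj : injective copy_map.
Proof. exact: can_inj copy_mapK. Qed.

Lemma edge_in_core (e : {set T}) : e \in edges G -> e != [set x; y] ->
  exists2 z, z \in e & in_core (copy_map z).
Proof.
move=> eG e_xy; have: ~~ (e \subset [set x; y]).
  by apply: contra e_xy => sub; rewrite eqEcard sub cards2 neq_xy (edges_card2 eG).
case/subsetPn=> z ze; rewrite !inE negb_or => zxy.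
by exists z; rewrite ?in_core_copy_map.
Qed.

Lemma copy_index_edge (e : {set T}) : e \in edges G -> e != [set x; y] ->
  copy_index (copy_map @: e) = i.
Proof.
move=> eG e_xy; rewrite /copy_index; case: pickP => [w /andP[/imsetP[z _ ->]]|].
  rewrite in_core_copy_map => /andP[zx zy].
  rewrite copy_map_core // divnMDl ?(leq_ltn_trans _ (index_enum_lt z)) //.
  by rewrite divn_small ?index_enum_lt ?addn0.
have [z ze zc] := edge_in_core _ eG e_xy.
by move/(_ (copy_map z)); rewrite zc imset_f.
Qed.

Lemma core_label_edge (e : {set T}) : e \in edges G -> e != [set x; y] ->
  core_label (copy_map @: e) =
    label G e * #|{set 'I_n}| + enum_rank (copy_map @: e).
Proof.
move=> eG e_xy; rewrite /core_label copy_index_edge // -imset_comp.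
by rewrite (eq_imset _ copy_mapK) imset_id.
Qed.

(** Distinct edges of [G] have distinct labels, so the primary components differ and the ranks never
    decide. *)
Lemma core_label_mono (e1 e2 : {set T}) : e1 \in edges G -> e2 \in edges G ->
  e1 != [set x; y] -> e2 != [set x; y] ->
  (core_label (copy_map @: e1) < core_label (copy_map @: e2)) =
    (label G e1 < label G e2).
Proof.
move=> e1G e2G e1_xy e2_xy; have [->|neq12] := eqVneq e1 e2; first by rewrite !ltnn.
rewrite !core_label_edge // ltn_lexi //.
by apply: contra neq12 => /eqP/(label_inj e1G e2G)->.
Qed.

Hypothesis xyG : [set x; y] \in edges G.
Hypothesis xy_first : forall e, e \in edges G -> label G [set x; y] <= label G e.

Lemma copy_in_add_first (uv2 : #|[set u; v]| = 2) :
  is_copy G (add_first core_graph uv2) (copy_map @: [set: T])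
    [set copy_map @: (e : {set T}) | e in edges G].
Proof.
have map_xy : copy_map @: [set x; y] = [set u; v].
  by rewrite imsetU1 imset_set1 copy_mapx copy_mapy.
split; first split.
- apply/fintype.subsetP=> _ /imsetP[e eG ->]; rewrite /= 2!inE.
  have [->|e_xy] := eqVneq e [set x; y]; first by rewrite map_xy eqxx.
  rewrite inE card_imset; last exact: copy_map_inj.
  rewrite (edges_card2 eG) eqxx /=; apply/orP; right.
  have [z ze zc] := edge_in_core _ eG e_xy.
  by apply/exists_inP; exists (copy_map z); rewrite ?imset_f.
- by move=> _ /imsetP[e _ ->]; apply/imsetS/finset.subsetT.
exists copy_map; split=> //; first exact: copy_map_inj.
move=> e1 e2 e1G e2G; rewrite /= /add_label -map_xy.
rewrite !(inj_eq (imset_inj copy_map_inj)).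
(* The image of [[set x; y]] is the added edge, of label 0, which matches its being first in [G]. *)
have [->|e2_xy] := eqVneq e2 [set x; y].
  by rewrite ltn0 ltnNge xy_first.
have [->|e1_xy] := eqVneq e1 [set x; y]; last by rewrite ltnS core_label_mono.
rewrite ltn0Sn ltn_neqAle xy_first // andbT.
by apply/esym; apply: contra e2_xy => /eqP/(label_inj xyG e2G)->.
Qed.

End Copy.

End Construction.

(** * Semisaturation and the bound for each [n] *)

Lemma core_graph_semisaturated (T : finType) (G : eograph T) (x y : T)
    (n L : nat) : x != y -> [set x; y] \in edges G ->
  (forall e, e \in edges G -> label G [set x; y] <= label G e) ->
  n <= 2 ^ L -> min_semisaturated G (core_graph _ G x y n L).
Proof.
move=> neq_xy xyG xy_first leqnL e e2.
have /cards2P[u [v [neq_uv def_e]]]: #|e| == 2 by rewrite e2.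
move: e2; rewrite {e}def_e => e2; rewrite inE e2 eqxx /= => /exists_inPn out.
have u_out : ~~ in_core T n L u by apply: out; rewrite set21.
have v_out : ~~ in_core T n L v by apply: out; rewrite set22.
have [||i ltiL neq_bit] := differ_bit L u v _ _ neq_uv.
- exact: leq_trans leqnL.
- exact: leq_trans leqnL.
(* The added edge is unordered, so its ends can be named such that [u] plays [x] and [v] plays
   [y]. *)
wlog u_bit : u v e2 neq_uv out u_out v_out neq_bit / ~~ odd (u %/ 2 ^ i).
  move=> IH; case: (boolP (odd (u %/ 2 ^ i))) => [u_bit|]; last exact: IH.
  have v_bit : ~~ odd (v %/ 2 ^ i) by move: neq_bit; rewrite u_bit; case: odd.
  move: e2 out; rewrite finset.setUC => e2 out.
  by apply: IH; rewrite // eq_sym.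
have v_bit : odd (v %/ 2 ^ i) by move: neq_bit; rewrite (negPf u_bit); case: odd.
exists (copy_map T x y n u v i @: [set: T]).
exists [set copy_map T x y n u v i @: (e : {set T}) | e in edges G].
split; first exact: (@copy_in_add_first _ _ _ _ _ L).
apply/imsetP; exists [set x; y] => //.
by rewrite imsetU1 imset_set1 copy_mapx copy_mapy.
Qed.

Lemma ssat_m_le (T : finType) (G : eograph T) (n L : nat) :
  0 < #|edges G| -> n <= 2 ^ L -> ssat_m n G <= #|T| * L * n.
Proof.
case/card_gt0P=> e0 e0G leqnL.
have [e1 e1G e1_first] := arg_minnP (label G) e0G.
have /cards2P[x [y [neq_xy def_e1]]]: #|e1| == 2 by rewrite (edges_card2 e1G).
rewrite {e1}def_e1 in e1G e1_first.
apply: leq_trans (card_core_edges T n L); rewrite /ssat_m.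
case: ex_minnP => m _; apply; apply/asboolP.
exists (core_graph _ G x y n L); split=> //.
exact: core_graph_semisaturated.
Qed.

(** * The asymptotic bound *)

Local Open Scope classical_set_scope.
Local Open Scope ring_scope.

(** Rounding up costs at most 1, and [ln 2 <= ln n] absorbs this 1 into a second [ln n], whence the
    factor 2. *)
Lemma up_log2_le_ln (R : realType) (n : nat) : (1 < n)%N ->
  (up_log 2 n)%:R <= 2 / ln 2 * ln n%:R :> R.
Proof.
move=> n_gt1; have ln2_gt0 : 0 < ln 2 :> R by rewrite ln_gt0 // ltr1n.
rewrite mulrAC ler_pdivlMr //.
have n_gt0 : 0 < n%:R :> R by rewrite ltr0n ltnW.
have le_ln : ln 2 <= ln n%:R :> R by rewrite ler_ln ?posrE // ler_nat.
have le_log : (up_log 2 n).-1%:R * ln 2 <= ln n%:R :> R.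
  rewrite mulr_natl -lnXn // ler_ln ?posrE ?exprn_gt0 //.
  by rewrite -natrX ler_nat ltnW // up_log_gtn.
have log_gt0 : (0 < up_log 2 n)%N by rewrite up_log_gt0.
rewrite -[up_log 2 n]prednK // -natr1 mulrDl mul1r [2 * _]mulr_natl mulr2n.
exact: lerD.
Qed.

Theorem theorem7 (R : realType) (T : finType) (G : eograph T)
    (hG : (0 < #|edges G|)%N) :
  (fun n : nat => (ssat_m n G)%:R : R^o) =O_\oo
  (fun n : nat => n%:R * ln (n%:R) : R^o).
Proof.
have ln2_gt0 : 0 < ln 2 :> R by rewrite ln_gt0 // ltr1n.
have [e /edges_card2 e2] := card_gt0P hG.
have T_gt0 : 0 < #|T|%:R :> R.
  by rewrite ltr0n (leq_trans _ (max_card (mem e))) ?e2.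
(* With [L = up_log 2 n], the factor [#|T|] comes from the size [#|T| * L] of the core and
   [2 / ln 2] from bounding [L] by [ln n]. *)
apply/eqO_exP; exists (#|T|%:R * (2 / ln 2)).
  by rewrite mulr_gt0 // divr_gt0.
near=> n; have n_gt1 : (1 < n)%N by near: n; exists 2.
have ln_ge0 : 0 <= ln n%:R :> R by rewrite ln_ge0 // ler1n ltnW.
rewrite ger0_norm // ger0_norm ?mulr_ge0 //.
apply: (@le_trans _ _ (#|T| * up_log 2 n * n)%:R).
  by rewrite ler_nat ssat_m_le // up_logP.
rewrite !natrM [leRHS]mulrCA [leRHS]mulrC ler_wpM2r // -mulrA ler_wpM2l //.
exact: up_log2_le_ln.
Unshelve. all: by end_near.
Qed.
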